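(* Let $p(z)=z^n+a_{n-1}z^{n-1}+\cdots+a_1z+a_0$ be a monic polynomial of degree $n\ge 2$ with coefficients $a_0,\dots,a_{n-1}\in\mathbb{C}$, let $C(p)$ be its Frobenius companion matrix, and let $\lambda$ be a zero of $p(z)$. Then $$|\lambda|\le w(C(p))\le\frac12\left[|a_{n-1}|+\cos\frac{\pi}{n}+\sqrt{\left(|a_{n-1}|-\cos\frac{\pi}{n}\right)^2+4\alpha^2}\right],$$ where $$\alpha=\left[\frac18\max\left\{(\beta+1)^2+4|a_{n-2}|^2,\ (\beta+1)^2+\delta^2\right\}\right]^{\frac14},\quad \beta=\sum_{r=0}^{n-2}|a_r|^2,\quad \delta=|a_{n-2}|+\sqrt{\sum_{r=0}^{n-2}|a_r|^2}.$$
   Context: The Frobenius companion matrix of $p$ is the $n\times n$ matrix $$C(p)=\begin{pmatrix}-a_{n-1}&-a_{n-2}&\cdots&-a_1&-a_0\\1&0&\cdots&0&0\\0&1&\cdots&0&0\\\vdots&\vdots&&\vdots&\vdots\\0&0&\cdots&1&0\end{pmatrix},$$ regarded as an operator on $\mathbb{C}^n$ with the usual inner product. The numerical radius of an operator $T$ on $\mathbb{C}^n$ is $w(T)=\sup\{|\langle Tx,x\rangle| : x\in\mathbb{C}^n,\ \|x\|=1\}$. *)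

(* Defs.v *)
From mathcomp Require Import all_boot all_order all_algebra.
From mathcomp Require Import all_classical all_reals all_analysis.
From mathcomp Require Import complex.

Set Implicit Arguments.
Unset Strict Implicit.
Unset Printing Implicit Defensive.

Import Order.TTheory GRing.Theory Num.Theory.
Local Open Scope classical_set_scope.
Local Open Scope ring_scope.
Local Open Scope complex_scope.

(* [normc] is the modulus as an element of [R]; [`|z|] would be in [R[i]]. *)
Notation normc := ComplexField.Normc.normc.

Section NumericalRadius.
Variables (R : realType) (n : nat).
Implicit Types (T : 'M[R[i]]_n) (x y : 'cV[R[i]]_n).

(* [dotmx] is the standard Hermitian product of row vectors, linear on the
   left and conjugate-linear on the right. *)
Definition inner x y : R[i] := dotmx x^T y^T.

(* The Euclidean norm; MathComp-Analysis puts the sup norm on matrices. *)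
Definition l2norm x : R := Num.sqrt (complex.Re (inner x x)).

(* For [n > 0] the set is nonempty and bounded, so [sup] is a genuine
   supremum. *)
Definition numerical_radius T : R :=
  sup [set r : R | exists2 x : 'cV[R[i]]_n,
                     l2norm x = 1 & r = normc (inner (T *m x) x)].

End NumericalRadius.

(* First row [-a_(n-1), ..., -a_0], ones on the subdiagonal; MathComp's
   [companionmx] has the coefficients in the last row, in the opposite order. *)
Definition frobenius_companion (F : nzRingType) (n : nat) (p : {poly F}) :
    'M[F]_n :=
  \matrix_(i < n, j < n)
    if i == 0 :> nat then - p`_(n.-1 - j) else (i == j.+1 :> nat)%:R.

Section Quantities.
Variables (R : realType) (n : nat) (p : {poly R[i]}).

Definition beta : R := \sum_(0 <= r < n.-1) normc p`_r ^+ 2.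

Definition delta : R :=
  normc p`_(n - 2) + Num.sqrt (\sum_(0 <= r < n.-1) normc p`_r ^+ 2).

Definition alpha : R :=
  (8^-1 * Num.max ((beta + 1) ^+ 2 + 4 * normc p`_(n - 2) ^+ 2)
                  ((beta + 1) ^+ 2 + delta ^+ 2)) `^ (4^-1).

End Quantities.

(* Main.v *)
Require Import Defs.
From mathcomp Require Import all_boot all_order all_algebra.
From mathcomp Require Import all_classical all_reals all_analysis.
From mathcomp Require Import complex ring lra.

(** Since [C(p)] has the eigenvector [(z ^ (n-1), ..., z, 1)] for every root [z]
    of [p], its numerical radius is at least [|z|].

    For the upper bound, split [C^n] into the first coordinate and the [n-1]
    others.  The companion matrix becomes a two by two block matrix: the corner
    is [- a_(n-1)], the lower diagonal block is the nilpotent shift of size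
    [n-1], and the off-diagonal blocks are the row
    [(- a_(n-2), ..., - a_0)] and the first basis vector.  Let [x] be a unit
    vector, [s] the modulus of its first coordinate and [t] the norm of the
    rest.  Then [|<C(p) x, x>|] is at most the sum of
    - [|a_(n-1)| * s ^ 2], from the corner;
    - [cos (pi / n) * t ^ 2], from the shift ([shift_form_le]);
    - [2 * alpha * s * t], from the off-diagonal blocks: Cauchy-Schwarz gives
      the factor [sqrt (beta + 1 + 2 |a_(n-2)|)] ([row_plus_pivot_le]), which
      is at most [2 * alpha] ([sqrt_le_alpha]).

    The largest value of this real quadratic form on [s ^ 2 + t ^ 2 = 1] is the
    bound of the theorem ([quad_form_le]).  Every estimate only involves the
    moduli of the coordinates of [x], so that the complex inner product is left
    behind after one use of the triangle inequality ([normc_inner_le]). *)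

Set Implicit Arguments.
Unset Strict Implicit.
Unset Printing Implicit Defensive.

Import Order.TTheory GRing.Theory Num.Theory.
Local Open Scope ring_scope.
Local Open Scope complex_scope.

(** * Inequalities in real fields *)

Lemma ler_sqrt_sqr (R : rcfType) (a b : R) : a ^+ 2 <= b -> a <= Num.sqrt b.
Proof.
move=> ab; rewrite (le_trans (ler_norm a))// -sqrtr_sqr ler_sqrt//.
exact: le_trans (sqr_ge0 a) ab.
Qed.

(** The Cauchy-Schwarz inequality, from Lagrange's identity: twice the
    difference of the two sides is the sum of all
    [(u i * v j - u j * v i) ^+ 2]. *)
Lemma sqr_sum_mul_le (R : realDomainType) (I : finType) (u v : I -> R) :
  (\sum_i u i * v i) ^+ 2 <= (\sum_i u i ^+ 2) * (\sum_i v i ^+ 2).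
Proof.
rewrite -subr_ge0 -(pmulr_rge0 _ (ltr0Sn R 1)).
suff -> : 2 * ((\sum_i u i ^+ 2) * (\sum_i v i ^+ 2) - (\sum_i u i * v i) ^+ 2)
    = \sum_i \sum_j (u i * v j - u j * v i) ^+ 2.
  by apply: sumr_ge0 => i _; apply: sumr_ge0 => j _; exact: sqr_ge0.
transitivity (\sum_i \sum_j (u i ^+ 2 * v j ^+ 2)
   + \sum_i \sum_j (u j ^+ 2 * v i ^+ 2)
   - 2 * \sum_i \sum_j ((u i * v i) * (u j * v j))); last first.
  rewrite mulr_sumr -sumrN -!big_split/=; apply: eq_bigr => i _.
  rewrite mulr_sumr -sumrN -!big_split/=; apply: eq_bigr => j _; ring.
rewrite [X in _ + X - _]exchange_big/= expr2 !big_distrlr/=; ring.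
Qed.

Lemma young_weighted (R : realFieldType) (x y a b : R) : 0 < a -> 0 < b ->
  2 * x * y <= x ^+ 2 * (b / a) + y ^+ 2 * (a / b).
Proof.
move=> a0 b0; rewrite -subr_ge0.
have -> : x ^+ 2 * (b / a) + y ^+ 2 * (a / b) - 2 * x * y
   = (x * b - y * a) ^+ 2 / (a * b) by field; rewrite !gt_eqF.
by rewrite divr_ge0 ?sqr_ge0// mulr_ge0// ltW.
Qed.

(** The nilpotent shift of size [m.+1] has numerical radius
    [cos (pi / m.+2)]; this is the upper bound, on real vectors.  With
    [t = pi / m.+2], the vector [v k = sin (k t)] is positive for
    [0 < k < m.+2], vanishes at both ends, and satisfies
    [v k + v k.+2 = 2 cos t * v k.+1].  The products are split by
    [young_weighted] with the weights [v]; each square then collects at most the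
    coefficient [(v k + v k.+2) / v k.+1], which is [2 cos t]. *)
Lemma shift_form_le (R : realType) (m : nat) (s : nat -> R) :
  \sum_(i < m) s i * s i.+1
    <= cos (pi / m.+2%:R) * \sum_(i < m.+1) s i ^+ 2.
Proof.
pose t : R := pi / m.+2%:R; rewrite -/t.
pose v (k : nat) : R := sin (k%:R * t).
have vrec k : v k + v k.+2 = 2 * cos t * v k.+1.
  have -> : v k = sin (k.+1%:R * t - t).
    by rewrite /v; congr sin; rewrite -natr1; ring.
  have -> : v k.+2 = sin (k.+1%:R * t + t).
    by rewrite /v; congr sin; rewrite -[k.+2%:R]natr1; ring.
  by rewrite !sinD sinN cosN /v; ring.
have v0 : v 0%N = 0 by rewrite /v mul0r sin0.
have vgt0 k : (0 < k < m.+2)%N -> 0 < v k.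
  move=> /andP[k0 km]; apply: sin_gt0_pi.
  rewrite mulr_gt0 ?ltr0n ?divr_gt0 ?pi_gt0 ?ltr0n//=.
  by rewrite /t mulrCA gtr_pMr ?pi_gt0// ltr_pdivrMr ?ltr0n// mul1r ltr_nat.
have vlast : v m.+2 = 0 by rewrite /v /t mulrC divfK ?pnatr_eq0// sinpi.
(* The extra term on the left is the part of [s k ^+ 2] that the next product
   will use; it vanishes for [k = m] since [v m.+2 = 0]. *)
suff main k : (k <= m)%N ->
    2 * (\sum_(i < k) s i * s i.+1) + s k ^+ 2 * (v k.+2 / v k.+1)
      <= 2 * cos t * \sum_(i < k.+1) s i ^+ 2.
  have := main m (leqnn m); rewrite vlast mul0r mulr0 addr0 -mulrA.
  by rewrite ler_pM2l.
elim: k => [_|k IH km].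
  rewrite big_ord0 big_ord1 mulr0 add0r mulrC ler_wpM2r ?sqr_ge0//.
  have := vrec 0%N; rewrite v0 add0r => ->.
  by rewrite mulfK// gt_eqF// vgt0.
have v1 : 0 < v k.+1 by rewrite vgt0//= ltnS leqW// ltnW.
have v2 : 0 < v k.+2 by rewrite vgt0//= ltnS ltnW.
rewrite big_ord_recr [X in _ <= _ * X]big_ord_recr/=.
have -> : v k.+3 / v k.+2 = 2 * cos t - v k.+1 / v k.+2.
  apply: (canRL (addrK _)); rewrite -mulrDl addrC vrec mulfK//.
  exact: lt0r_neq0.
have := IH (ltnW km); have := young_weighted (s k) (s k.+1) v1 v2.
lra.
Qed.

(** The right-hand side is the largest eigenvalue of the symmetric matrix with
    rows [(u, a)] and [(a, c)].  On the unit circle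
    [p = s ^+ 2 - t ^+ 2] and [q = 2 * s * t] satisfy [p ^+ 2 + q ^+ 2 = 1], and
    the form is half of [u + c + ((u - c) * p + 2 * a * q)], so that
    Cauchy-Schwarz in the plane gives the bound. *)
Lemma quad_form_le (R : rcfType) (u c a s t : R) : s ^+ 2 + t ^+ 2 = 1 ->
  u * s ^+ 2 + 2 * a * s * t + c * t ^+ 2
    <= 2^-1 * (u + c + Num.sqrt ((u - c) ^+ 2 + 4 * a ^+ 2)).
Proof.
move=> st.
have : (u - c) * (s ^+ 2 - t ^+ 2) + 4 * a * s * t
    <= Num.sqrt ((u - c) ^+ 2 + 4 * a ^+ 2).
  apply: ler_sqrt_sqr.
  have -> : (u - c) ^+ 2 + 4 * a ^+ 2
      = ((u - c) ^+ 2 + 4 * a ^+ 2) * (s ^+ 2 + t ^+ 2) ^+ 2.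
    by rewrite st expr1n mulr1.
  rewrite -subr_ge0; set d := (X in 0 <= X).
  (* Lagrange's identity for the vectors [(u - c, 2 * a)] and [(p, q)]. *)
  have -> : d = ((u - c) * (2 * s * t) - 2 * a * (s ^+ 2 - t ^+ 2)) ^+ 2.
    by rewrite /d; ring.
  exact: sqr_ge0.
have : (u + c) * (s ^+ 2 + t ^+ 2) = u + c by rewrite st mulr1.
lra.
Qed.

(** * The off-diagonal part and the constant alpha *)

(** The bound for the off-diagonal part of the companion matrix: a first row
    [b] and a one below the corner combine, in absolute values, into the row
    [b] with its first entry increased by one, whose squared norm stands under
    the first root. *)
Lemma row_plus_pivot_le (R : rcfType) (m : nat) (b s : 'I_m.+1 -> R) :
  \sum_j b j * s j + s ord0
    <= Num.sqrt (\sum_j b j ^+ 2 + 1 + 2 * b ord0)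
       * Num.sqrt (\sum_j s j ^+ 2).
Proof.
pose b' j := b j + (j == ord0)%:R.
have -> : \sum_j b j * s j + s ord0 = \sum_j b' j * s j.
  rewrite /b' big_ord_recl [RHS]big_ord_recl/= ?eqxx.
  under [in RHS]eq_bigr do rewrite addr0.
  ring.
have -> : \sum_j b j ^+ 2 + 1 + 2 * b ord0 = \sum_j b' j ^+ 2.
  rewrite /b' big_ord_recl [RHS]big_ord_recl/= ?eqxx.
  under [in RHS]eq_bigr do rewrite addr0.
  ring.
rewrite -sqrtrM ?sumr_ge0// => [|j _]; last exact: sqr_ge0.
exact/ler_sqrt_sqr/sqr_sum_mul_le.
Qed.

(** With [Y = beta + 1 + 2 * |a_(n-2)|], the inequality
    [(u + v) ^+ 2 <= 2 * u ^+ 2 + 2 * v ^+ 2] bounds [Y ^+ 2] by twice the first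
    argument of the maximum in [alpha], so [(Y / 4) ^+ 2 <= alpha ^+ 4]. *)
Lemma sqrt_le_alpha (R : realType) (n : nat) (p : {poly R[i]}) :
  Num.sqrt (beta n p + 1 + 2 * normc p`_(n - 2)) <= 2 * alpha n p.
Proof.
rewrite /alpha; set a := normc _; set b := beta n p; set X := _ * Num.max _ _.
have X_ge : ((b + 1 + 2 * a) / 4) ^+ 2 <= X.
  have : (b + 1) ^+ 2 + 4 * a ^+ 2 <= 8 * X.
    by rewrite /X mulVKf ?pnatr_eq0// le_max lexx.
  have := sqr_ge0 (b + 1 - 2 * a); lra.
have X_ge0 : 0 <= X by apply: le_trans X_ge; exact: sqr_ge0.
have alpha2 : (X `^ 4^-1) ^+ 2 = Num.sqrt X.
  rewrite -powR_mulrn ?powR_ge0// -powRrM -powR12_sqrt//; congr (_ `^ _).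
  lra.
have /ler_sqrt_sqr := X_ge; rewrite -alpha2 => h.
rewrite -[leRHS]ger0_norm ?mulr_ge0 ?powR_ge0// -sqrtr_sqr ler_sqrt ?sqr_ge0//.
lra.
Qed.

(** * Modulus, inner product and numerical radius *)

Lemma normc_ge0 (R : rcfType) (z : R[i]) : 0 <= normc z.
Proof. by case: z => a b; exact: sqrtr_ge0. Qed.

Lemma normc_conj (R : rcfType) (z : R[i]) : normc z^*%C = normc z.
Proof. by case: z => a b; rewrite /= sqrrN. Qed.

Lemma mulc_conj (R : rcfType) (z : R[i]) : z * z^*%C = (normc z ^+ 2)%:C.
Proof. by rewrite -sqr_normc rmorphXn. Qed.

Lemma normc_sum_le (R : rcfType) (I : Type) (r : seq I) (F : I -> R[i]) :
  normc (\sum_(i <- r) F i) <= \sum_(i <- r) normc (F i).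
Proof.
elim/big_ind2: _ => [|z a w b za wb|//]; first by rewrite Normc.normc0.
exact: le_trans (le_normcD _ _) (lerD za wb).
Qed.

Lemma innerE (R : realType) (n : nat) (x y : 'cV[R[i]]_n) :
  inner x y = \sum_i x i 0 * (y i 0)^*%C.
Proof. by rewrite /inner dotmxE mxE; apply: eq_bigr => i _; rewrite !mxE. Qed.

Lemma inner_self (R : realType) (n : nat) (x : 'cV[R[i]]_n) :
  inner x x = (\sum_i normc (x i 0) ^+ 2)%:C.
Proof.
by rewrite innerE rmorph_sum/=; apply: eq_bigr => i _; rewrite mulc_conj.
Qed.

Lemma l2normE (R : realType) (n : nat) (x : 'cV[R[i]]_n) :
  l2norm x = Num.sqrt (\sum_i normc (x i 0) ^+ 2).
Proof. by rewrite /l2norm inner_self. Qed.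

Lemma l2norm1 (R : realType) (n : nat) (x : 'cV[R[i]]_n) :
  (l2norm x = 1) <-> (\sum_i normc (x i 0) ^+ 2 = 1).
Proof.
rewrite l2normE; split=> [h|->]; last exact: sqrtr1.
rewrite -[LHS]sqr_sqrtr ?h ?expr1n// sumr_ge0// => i _; exact: sqr_ge0.
Qed.

(** Passing to the moduli of the entries reduces the upper bound to an
    inequality between real quadratic forms. *)
Lemma normc_inner_le (R : realType) (n : nat) (T : 'M[R[i]]_n)
    (x : 'cV[R[i]]_n) :
  normc (inner (T *m x) x)
    <= \sum_i \sum_j normc (T i j) * normc (x j 0) * normc (x i 0).
Proof.
rewrite innerE (le_trans (normc_sum_le _ _))//; apply: ler_sum => i _.
rewrite Normc.normcM normc_conj -mulr_suml ler_wpM2r ?normc_ge0//.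
rewrite mxE (le_trans (normc_sum_le _ _))//; apply: ler_sum => j _.
by rewrite Normc.normcM.
Qed.

Lemma scale_unit (R : realType) (n : nat) (x : 'cV[R[i]]_n) : x != 0 ->
  exists c : R[i], l2norm (c *: x) = 1.
Proof.
move=> x0; have [i xi0] : exists i, x i 0 != 0.
  apply/existsP; apply: contraNT x0; rewrite negb_exists => /forallP h.
  by apply/eqP/colP => i; rewrite mxE; apply/eqP; have := h i; rewrite negbK.
set N := \sum_i normc (x i 0) ^+ 2.
have N_gt0 : 0 < N.
  rewrite /N (bigD1 i)//= ltr_pwDl ?sumr_ge0// => [|j _]; last exact: sqr_ge0.
  rewrite exprn_gt0// lt0r normc_ge0 andbT.
  by apply: contra xi0 => /eqP/Normc.eq0_normc ->.
exists (Num.sqrt N)^-1%:C; apply/l2norm1.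
under eq_bigr do rewrite mxE Normc.normcM exprMn.
rewrite -mulr_sumr -/N /= expr0n addr0 sqr_sqrtr ?sqr_ge0//.
by rewrite exprVn sqr_sqrtr ?mulVf ?gt_eqF// ltW.
Qed.

Lemma normc_inner_eigen (R : realType) (n : nat) (T : 'M[R[i]]_n) (z : R[i])
    (x : 'cV[R[i]]_n) :
  T *m x = z *: x -> l2norm x = 1 -> normc (inner (T *m x) x) = normc z.
Proof.
move=> -> /l2norm1 x1; rewrite innerE.
under eq_bigr do rewrite mxE -mulrA.
by rewrite -mulr_sumr -innerE inner_self x1 mulr1.
Qed.

Lemma numerical_radius_le (R : realType) (n : nat) (T : 'M[R[i]]_n.+1) (b : R) :
  (forall x, l2norm x = 1 -> normc (inner (T *m x) x) <= b) ->
  numerical_radius T <= b.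
Proof.
move=> Tb; apply: ge_sup => [|_ [x x1 ->]]; last exact: Tb.
have [|c c1] := @scale_unit R n.+1 (const_mx 1).
  by apply/eqP => /colP/(_ 0); rewrite !mxE; exact/eqP/oner_neq0.
by eexists; exists (c *: const_mx 1).
Qed.

(** On a unit eigenvector the quadratic form takes the value [z].  The supremum
    defining the numerical radius bounds this value only because the set is
    bounded, here by the sum of the moduli of all entries of [T]. *)
Lemma eigenvalue_le_numerical_radius (R : realType) (n : nat)
    (T : 'M[R[i]]_n) (z : R[i]) (x : 'cV[R[i]]_n) :
  x != 0 -> T *m x = z *: x -> normc z <= numerical_radius T.
Proof.
move=> /scale_unit[c c1] Tx; apply: ub_le_sup; last first.
  exists (c *: x) => //; rewrite (@normc_inner_eigen _ _ _ z)//.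
  by rewrite -scalemxAr Tx !scalerA mulrC.
exists (\sum_i \sum_j normc (T i j)) => _ [y /l2norm1 y1 ->].
have y_le1 i : normc (y i 0) <= 1.
  rewrite -(@ler_pXn2r _ 2) ?nnegrE ?normc_ge0// expr1n -y1 (bigD1 i)//=.
  by rewrite lerDl sumr_ge0// => j _; exact: sqr_ge0.
apply: le_trans (normc_inner_le _ _) _.
apply: ler_sum => i _; apply: ler_sum => j _.
by rewrite -mulrA ler_piMr ?normc_ge0// mulr_ile1 ?normc_ge0.
Qed.

(** * The companion matrix *)

(** The rows below the first one shift the powers of [z]; the first row gives
    [z] times the top entry exactly because [p.[z] = 0]. *)
Lemma companion_eigenvector (F : fieldType) (m : nat) (p : {poly F}) (z : F) :
  p \is monic -> size p = m.+2 -> root p z ->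
  frobenius_companion m.+1 p *m (\col_i z ^+ (m - i))
    = z *: (\col_i z ^+ (m - i)).
Proof.
move=> p_monic p_size /rootP pz; apply/colP => i; rewrite !mxE -exprS.
case: i => [[|i] im]; rewrite /= ?subn0; last first.
  rewrite (bigD1 (Ordinal (ltnW im)))//= big1 ?addr0 => [|j /eqP ji].
    by rewrite !mxE /= eqxx mul1r -subSn.
  rewrite !mxE/=; case: eqP => [[ij]|]; last by rewrite mul0r.
  by case: ji; apply: val_inj.
move: pz; rewrite horner_coef p_size big_ord_recr/=.
have -> : p`_(m.+1) = 1 by have /monicP := p_monic; rewrite lead_coefE p_size.
rewrite mul1r addrC => /eqP; rewrite addr_eq0 => /eqP ->.
(* The first row lists the coefficients in decreasing order of degree. *)
rewrite (reindex_inj rev_ord_inj)/= -sumrN.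
apply: eq_bigr => j _; rewrite !mxE /= !subSS mulNr.
by rewrite subKn // -ltnS.
Qed.

(** The form splits along the first coordinate and the remaining ones: the
    corner entry, the coupling of the two blocks, and a shift of size [m.+1]. *)
Lemma companion_form_le (R : realType) (m : nat) (p : {poly R[i]})
    (x : 'cV[R[i]]_m.+2) (s : nat -> R) :
  (forall i : 'I_m.+2, normc (x i 0) = s i) ->
  normc (inner (frobenius_companion m.+2 p *m x) x)
    <= normc p`_m.+1 * s 0 ^+ 2
       + s 0 * (\sum_(j < m.+1) normc p`_(m - j) * s j.+1 + s 1)
       + \sum_(i < m) s i.+1 * s i.+2.
Proof.
move=> sE.
apply: le_trans (normc_inner_le _ _) _.
rewrite big_ord_recl; under eq_bigr do rewrite mxE/= normcN !sE.
rewrite [X in X + _ <= _]big_ord_recl/= subn0.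
have subdiag (i : 'I_m.+1) :
    \sum_j normc (frobenius_companion m.+2 p (lift ord0 i) j)
       * normc (x j 0) * normc (x (lift ord0 i) 0) = s i * s i.+1.
  rewrite (bigD1 (widen_ord (leqnSn _) i))//= big1 ?addr0 => [|j /eqP ji].
    by rewrite mxE/= eqxx Normc.normc1 mul1r !sE.
  rewrite !mxE/=; case: eqP => [[ij]|_]; last by rewrite Normc.normc0 !mul0r.
  by case: ji; apply: val_inj; rewrite /= -ij.
under [X in _ + X]eq_bigr do rewrite subdiag.
rewrite [X in _ + X]big_ord_recl/=.
under eq_bigr do rewrite subSS.
rewrite -mulr_suml.
lra.
Qed.

(** Each of the three parts of [companion_form_le] is bounded by an entry of the
    form [quad_form_le] evaluated at [s 0] and at the norm of the remaining
    coordinates. *)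
Lemma companion_inner_le (R : realType) (m : nat) (p : {poly R[i]})
    (x : 'cV[R[i]]_m.+2) : l2norm x = 1 ->
  normc (inner (frobenius_companion m.+2 p *m x) x)
    <= 2^-1 * (normc p`_m.+1 + cos (pi / m.+2%:R)
               + Num.sqrt ((normc p`_m.+1 - cos (pi / m.+2%:R)) ^+ 2
                           + 4 * alpha m.+2 p ^+ 2)).
Proof.
move=> /l2norm1; pose s (k : nat) := normc (x (inord k) 0).
have sE (i : 'I_m.+2) : normc (x i 0) = s i by rewrite /s inord_val.
have s_ge0 k : 0 <= s k by exact: normc_ge0.
under eq_bigr do rewrite sE.
rewrite big_ord_recl/= => s1.
apply: le_trans (companion_form_le p sE) _.
set Q := \sum_(j < m.+1) s j.+1 ^+ 2.
have Q_ge0 : 0 <= Q by apply: sumr_ge0 => j _; exact: sqr_ge0.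
have sQ : s 0%N ^+ 2 + Num.sqrt Q ^+ 2 = 1 by rewrite sqr_sqrtr.
apply: le_trans (quad_form_le (normc p`_m.+1) (cos (pi / m.+2%:R))
  (alpha m.+2 p) sQ).
apply: lerD; last first.
  by rewrite sqr_sqrtr//; exact: (shift_form_le m (fun k => s k.+1)).
have rowE : \sum_(j < m.+1) normc p`_(m - j) ^+ 2 = beta m.+2 p.
  by rewrite /beta big_rev_mkord subn0; apply: eq_bigr => j _; rewrite subSS.
have := row_plus_pivot_le (fun j : 'I_m.+1 => normc p`_(m - j))
  (fun j => s j.+1).
rewrite rowE /= subn0 -/Q => row_le.
have := sqrt_le_alpha m.+2 p; rewrite subSS subn1 /= => alpha_ge.
rewrite lerD2l [leRHS]mulrAC [leRHS]mulrC; apply: ler_wpM2l => //.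
by apply: le_trans row_le _; apply: ler_wpM2r; rewrite ?sqrtr_ge0.
Qed.

Theorem theorem3p4 (R : realType) (n : nat) (p : {poly R[i]}) (lambda : R[i])
    (n_ge2 : (2 <= n)%N) (p_monic : p \is monic) (p_deg : size p = n.+1)
    (p_lambda : root p lambda) :
  normc lambda <= numerical_radius (frobenius_companion n p) /\
  numerical_radius (frobenius_companion n p) <=
    2^-1 * (normc p`_(n - 1) + cos (pi / n%:R)
            + Num.sqrt ((normc p`_(n - 1) - cos (pi / n%:R)) ^+ 2
                        + 4 * alpha n p ^+ 2)).
Proof.
case: n n_ge2 p_deg => [|[|m]]// _ p_deg; split; last first.
  by rewrite subn1; apply: numerical_radius_le => x; exact: companion_inner_le.
apply: eigenvalue_le_numerical_radius (companion_eigenvector _ _ _) => //.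
(* The last entry of the eigenvector is [lambda ^+ 0 = 1]. *)
apply/eqP => /colP/(_ ord_max); rewrite !mxE subnn expr0.
exact/eqP/oner_neq0.
Qed.
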